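(* Let $d\geq 1$ and let $p\in\mathbb{R}[x]$ have degree at most $d$. Let $(a,b)$ be the $\mathcal{I}_d$-decomposition of $p$, and suppose that both $a$ and $b$ have only nonnegative coefficients. Let $f(x)=(1+x)^d p\left(\frac{x}{1+x}\right)$ be the $f$-polynomial of $p$ with respect to $d$. Then the following are equivalent: (1) $b\prec a$; (2) $a\prec p$; (3) $b\prec p$; (4) $\mathcal{I}_d(p)\prec p$; (5) $\mathcal{R}_d(f)\prec f$.
   Context: For a polynomial $p$ of degree at most $d$, $\mathcal{I}_d(p)(x)=x^dp(1/x)$ and $\mathcal{R}_d(p)(x)=(-1)^dp(-1-x)$. Every $p$ of degree at most $d$ can be written uniquely as $p=a+xb$ with $\deg a\le d$, $\deg b\le d-1$, $\mathcal{I}_d(a)=a$ and $\mathcal{I}_{d-1}(b)=b$; the pair $(a,b)$ is the $\mathcal{I}_d$-decomposition of $p$. Interlacing: the zeros of two real-rooted polynomials $p,q$ interlace if there is a zero of $p$ between each pair of zeros of $q$ (counted with multiplicity) and vice versa. We write $p\prec q$ if $p$ and $q$ are real-rooted, their zeros interlace, and the Wronskian $p'q-pq'$ is $\le 0$ on all of $\mathbb{R}$; by convention the zero polynomial is real-rooted and $0\prec p$, $p\prec 0$ for every real-rooted $p$. Equivalently, for $p,q\in\mathbb{R}[x]$, $p\prec q$ iff $q+ip$ is either identically zero or has no zeros with positive imaginary part. *)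

(* Defs.v *)
From HB Require Import structures.
From mathcomp Require Import all_boot all_order all_algebra.
From mathcomp Require Import reals.
Set Implicit Arguments.
Unset Strict Implicit.
Unset Printing Implicit Defensive.
Import Order.TTheory GRing.Theory Num.Theory.
Local Open Scope ring_scope.

Section Operators.
Variable R : realType.
Implicit Types (d : nat) (p q a b : {poly R}).

(* x^d p(1/x), expanded termwise; only meaningful for size p <= d.+1. *)
Definition Irev d p : {poly R} := \sum_(i < d.+1) p`_i *: 'X^(d - i).

Definition Rrefl d p : {poly R} := (-1) ^+ d *: (p \Po (- 1 - 'X)).

(* (1 + x)^d p(x / (1 + x)), expanded termwise; only meaningful for
   size p <= d.+1. *)
Definition fpoly d p : {poly R} :=
  \sum_(i < d.+1) p`_i *: ('X^i * (1 + 'X) ^+ (d - i)).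

Definition Idecomposition d p a b : Prop :=
  [/\ p = a + 'X * b, (size a <= d.+1)%N, (size b <= d)%N,
      Irev d a = a & Irev d.-1 b = b].

Lemma horner_Irev d p x : (size p <= d.+1)%N -> x != 0 ->
  (Irev d p).[x] = x ^+ d * p.[x^-1].
Proof.
move=> sp x0; rewrite (horner_coef_wide _ sp) /Irev horner_sum mulr_sumr.
apply: eq_bigr => i _; rewrite hornerZ hornerXn mulrCA exprVn.
by rewrite -expfB_cond // (negPf x0) -ltnS ltn_ord.
Qed.

Lemma horner_Rrefl d p x : (Rrefl d p).[x] = (-1) ^+ d * p.[- 1 - x].
Proof. by rewrite hornerZ horner_comp !hornerE. Qed.

Lemma horner_fpoly d p x : (size p <= d.+1)%N -> 1 + x != 0 ->
  (fpoly d p).[x] = (1 + x) ^+ d * p.[x / (1 + x)].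
Proof.
move=> sp x0; rewrite (horner_coef_wide _ sp) /fpoly horner_sum mulr_sumr.
apply: eq_bigr => i _; rewrite hornerZ hornerM hornerXn horner_exp.
rewrite hornerD -[1 in LHS]/(1%:P) hornerC hornerX.
have hi : (i <= d)%N by rewrite -ltnS ltn_ord.
have -> : (1 + x) ^+ d = (1 + x) ^+ (d - i) * (1 + x) ^+ i.
  by rewrite -exprD subnK.
rewrite -!mulrA [_ ^+ i * (p`_i * _)]mulrCA -exprMn (mulrC (1 + x)) divfK //.
by rewrite [RHS]mulrCA [x ^+ i * _]mulrC.
Qed.

End Operators.

Section Interlacing.
Variable R : realType.
Implicit Types (p q : {poly R}) (s t : seq R).

(* For p != 0, s lists the zeros of p with multiplicity and p has no others;
   for p = 0 it holds of every s. *)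
Definition zeros_of p s : Prop :=
  p = lead_coef p *: \prod_(z <- s) ('X - z%:P).

Definition real_rooted p : Prop := exists s, zeros_of p s.

(* s_0 <= t_0 <= s_1 <= t_1 <= ..., with both lists exhausted; in particular
   s and t are then sorted.  Counting with multiplicity means that consecutive
   gaps must be filled by distinct list entries, so a zero of one polynomial
   cannot serve two gaps of the other, as 1 would for [:: 0; 1; 2]. *)
Definition alternating s t : Prop :=
  [/\ (size t <= size s <= (size t).+1)%N,
      forall i, (i < size t)%N -> s`_i <= t`_i
    & forall i, (i.+1 < size s)%N -> t`_i <= s`_i.+1].

Definition zeros_interlace p q : Prop :=
  exists s t, [/\ zeros_of p s, zeros_of q t
                & alternating s t \/ alternating t s].

Definition prec p q : Prop :=
  [/\ real_rooted p, real_rooted q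
    & [\/ p = 0, q = 0
        | zeros_interlace p q /\
          forall x, (p^`() * q - p * q^`()).[x] <= 0]].

End Interlacing.

(* Main.v *)
Require Import Defs.
From HB Require Import structures.
From mathcomp Require Import all_boot all_order all_algebra.
From mathcomp Require Import reals polyrcf ring lra zify.
Set Implicit Arguments.
Unset Strict Implicit.
Unset Printing Implicit Defensive.
Import Order.TTheory GRing.Theory Num.Theory.
Local Open Scope ring_scope.

(** For p != 0, p ≺ q says that q / p is a Pick function: a real-rooted p
    interlaces q in this orientation exactly when
      q / p = al x + be - sum_z c_z / (x - z)   with al >= 0 and all c_z >= 0.
    From p ≺ q to partial fractions one cancels common zeros and reads the signs
    of the residues and of al off the Wronskian; conversely the residues force
    sign changes of q between consecutive zeros of p, and the affine part decides
    whether there are further zeros beyond the extreme ones.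

    Partial fractions are visibly stable under adding an affine function of
    nonnegative slope and under precomposition with x / (1 + e x), and if p, q are
    nonnegative to the right of u then p ≺ q implies q ≺ (x - u) p.  Since
    I_d(p) = a + b and p - (a + b) = (x - 1) b, the first four conditions are linked
    by these rules with u = 0 and u = 1.  Since R_d(f_d(p)) = f_d(I_d(p)), the last
    two are exchanged by the substitution x / (1 + x) and its inverse. *)

(** * Zeros with multiplicity, and cancellation of a common zero *)

Section ZeroLists.
Variable R : realType.
Implicit Types (p q : {poly R}) (s t : seq R) (u x : R).

Lemma zeros_ofM p q s t :
  zeros_of p s -> zeros_of q t -> zeros_of (p * q) (s ++ t).
Proof.
rewrite /zeros_of lead_coefM big_cat => {1}-> {1}->.
by rewrite /= -scalerAl -scalerAr scalerA.
Qed.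

Lemma zeros_of_perm p s t : perm_eq s t -> zeros_of p s -> zeros_of p t.
Proof. by rewrite /zeros_of => /(perm_big _) <-. Qed.

Lemma zeros_of_XsubC u : zeros_of ('X - u%:P) [:: u].
Proof. by rewrite /zeros_of lead_coefXsubC scale1r big_seq1. Qed.

Lemma zeros_ofN p s : zeros_of p s -> zeros_of (- p) s.
Proof. by rewrite /zeros_of lead_coefN scaleNr => {1}->. Qed.

Lemma root_zeros p s x : p != 0 -> zeros_of p s -> root p x = (x \in s).
Proof. by move=> p0 ->; rewrite rootZ ?lead_coef_eq0 // root_prod_XsubC. Qed.

Lemma size_zeros p s : p != 0 -> zeros_of p s -> size p = (size s).+1.
Proof.
by move=> p0 ->; rewrite size_scale ?lead_coef_eq0 // size_prod_XsubC.
Qed.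

Lemma zeros_of_mulXsubC u p s : p != 0 -> zeros_of (('X - u%:P) * p) s ->
  exists2 s', perm_eq s (u :: s') & zeros_of p s'.
Proof.
move=> p0 h.
have us : u \in s.
  rewrite -(root_zeros u _ h) ?rootM ?root_XsubC ?eqxx //.
  by rewrite mulf_neq0 ?polyXsubC_eq0.
exists (rem u s); first exact: perm_to_rem.
have X0 : 'X - u%:P != 0 :> {poly R} by rewrite polyXsubC_eq0.
apply: (mulfI X0); rewrite {1}h lead_coefM lead_coefXsubC mul1r.
by rewrite (perm_big _ (perm_to_rem us)) big_cons -scalerAr.
Qed.

Lemma real_rootedM p q : real_rooted p -> real_rooted q -> real_rooted (p * q).
Proof. by move=> [s hs] [t ht]; exists (s ++ t); apply: zeros_ofM. Qed.

Lemma real_rooted0 : real_rooted (0 : {poly R}).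
Proof. by exists [::]; rewrite /zeros_of lead_coef0 scale0r. Qed.

Lemma real_rootedC c : real_rooted (c%:P : {poly R}).
Proof. by exists [::]; rewrite /zeros_of lead_coefC big_nil alg_polyC. Qed.

Lemma real_rootedN p : real_rooted p -> real_rooted (- p).
Proof. by case=> s /zeros_ofN; exists s. Qed.

Lemma real_rooted_mulXsubC u p :
  real_rooted (('X - u%:P) * p) -> real_rooted p.
Proof.
have [->|p0] := eqVneq p 0; first by move=> _; exact: real_rooted0.
by case=> s /zeros_of_mulXsubC -/(_ p0) [s' _ h]; exists s'.
Qed.

Lemma real_rooted_linear (a b : R) : real_rooted (a *: 'X + b%:P).
Proof.
have [->|a0] := eqVneq a 0; first by rewrite scale0r add0r; exact: real_rootedC.
have -> : a *: 'X + b%:P = a%:P * ('X - (- b / a)%:P).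
  rewrite mulrBr mul_polyC -polyCM; congr (_ + _); rewrite -polyCN; congr _%:P.
  by field.
apply: real_rootedM; first exact: real_rootedC.
by exists [:: - b / a]; exact: zeros_of_XsubC.
Qed.

(* Counting zeros below a level makes alternation invariant under inserting or
   removing a common zero. *)
Definition interlaced s t :=
  forall x, (count (<= x)%O t <= count (<= x)%O s <= (count (<= x)%O t).+1)%N.

Lemma alternating_sorted s t : alternating s t ->
  sorted <=%O s /\ sorted <=%O t.
Proof.
case=> /andP [sz1 sz2] h1 h2; split; apply/(sortedP 0) => i hi.
  apply: (le_trans (h1 i _) (h2 i hi)); rewrite -ltnS.
  exact: leq_trans hi sz2.
by apply: (le_trans (h2 i _) (h1 i.+1 hi)); exact: leq_trans hi sz1.
Qed.

(** In a sorted list the entries at most [x] form a prefix, so statements about positions and about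
    counts translate into each other. *)
Lemma ltn_count_nth s x i : sorted <=%O s ->
  (i < count (<= x)%O s)%N = (i < size s)%N && (s`_i <= x).
Proof.
move=> ss; apply/idP/andP => [h|[hi hx]].
  split; first exact: leq_trans h (count_size _ _).
  exact: (nth_count_le 0 ss).
rewrite -(cat_take_drop i.+1 s) count_cat.
have -> : count (<= x)%O (take i.+1 s) = i.+1; last by rewrite leq_addr.
have sz : size (take i.+1 s) = i.+1 by rewrite size_takel.
rewrite -[RHS]sz; apply/eqP; rewrite -all_count; apply/(all_nthP 0) => j.
rewrite sz => hj; rewrite nth_take //; apply: le_trans hx.
by rewrite (sorted_leq_nth le_trans lexx 0 ss) // !inE (leq_trans _ hi) //.
Qed.

Lemma interlacedP s t : sorted <=%O s -> sorted <=%O t ->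
  alternating s t <-> interlaced s t.
Proof.
move=> ss st; split=> [[/andP [sz1 sz2] h1 h2] x|h].
  apply/andP; split.
    rewrite leqNgt ltn_count_nth //; apply/negP => /andP [hi hx].
    suff : (count (<= x)%O s < count (<= x)%O s)%N by rewrite ltnn.
    by rewrite ltn_count_nth // (leq_trans hi) //= (le_trans (h1 _ hi)).
  rewrite leqNgt ltn_count_nth //; apply/negP => /andP [hi hx].
  suff : (count (<= x)%O t < count (<= x)%O t)%N by rewrite ltnn.
  rewrite ltn_count_nth // (le_trans (h2 _ hi)) // andbT.
  by move: (leq_trans hi sz2); rewrite ltnS => ->.
split.
(* At a level above every entry the counts are the full lengths. *)
- pose M := \big[Num.max/0]_(z <- s ++ t) z.
  have hM z : z \in s ++ t -> z <= M.
    by rewrite /M; elim: (s ++ t) => // y l IH; rewrite inE big_cons le_max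
      => /orP [/eqP ->|/IH ->]; rewrite ?lexx ?orbT.
  have := h M.
  have -> : count (<= M)%O t = size t.
    by apply/eqP; rewrite -all_count; apply/allP => z hz; rewrite /= hM // mem_cat hz orbT.
  suff -> : count (<= M)%O s = size s by [].
  by apply/eqP; rewrite -all_count; apply/allP => z hz; rewrite /= hM // mem_cat hz.
- move=> i hi; have /andP [h1 _] := h t`_i.
  have : (i < count (<= (t`_i)%R)%O t)%N by rewrite ltn_count_nth // hi lexx.
  by move=> /leq_trans -/(_ _ h1); rewrite ltn_count_nth // => /andP [].
- move=> i hi; have /andP [_ h1] := h s`_i.+1.
  have : (i.+1 < count (<= (s`_i.+1)%R)%O s)%N by rewrite ltn_count_nth // hi lexx.
  by move=> /leq_trans -/(_ _ h1); rewrite ltnS ltn_count_nth // => /andP [].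
Qed.

Lemma interlaced_perm s s' t t' : perm_eq s s' -> perm_eq t t' ->
  interlaced s t -> interlaced s' t'.
Proof. by move=> /permP e1 /permP e2 h x; rewrite -e1 -e2; apply: h. Qed.

Lemma interlaced_cons u s t : interlaced (u :: s) (u :: t) <-> interlaced s t.
Proof. by split=> h x; have := h x; rewrite /= -addnS !leq_add2l. Qed.

(** Sorting restores [alternating], so zeros may be listed in any order. *)
Lemma zeros_interlaceP p q : zeros_interlace p q <->
  exists s t, [/\ zeros_of p s, zeros_of q t & interlaced s t \/ interlaced t s].
Proof.
split=> [[s [t [hs ht h]]]|[s [t [hs ht h]]]].
  exists s, t; split=> //; case: h => h; [left|right];
    by have [s1 s2] := alternating_sorted h; apply/interlacedP.
have es := permEl (perm_sort <=%O s); have et := permEl (perm_sort <=%O t).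
have ss := sort_le_sorted s; have st := sort_le_sorted t.
have es' := es; have et' := et; rewrite perm_sym in es'; rewrite perm_sym in et'.
exists (sort <=%O s), (sort <=%O t); split.
- exact: zeros_of_perm hs.
- exact: zeros_of_perm ht.
- case: h => h; [left|right]; apply/interlacedP => //; exact: interlaced_perm h.
Qed.

Lemma zeros_interlace_mulXsubC u p q : p != 0 -> q != 0 ->
  zeros_interlace (('X - u%:P) * p) (('X - u%:P) * q) <-> zeros_interlace p q.
Proof.
move=> p0 q0; split=> /zeros_interlaceP [s [t [hs ht h]]]; apply/zeros_interlaceP.
  have [s' es hs'] := zeros_of_mulXsubC p0 hs.
  have [t' et ht'] := zeros_of_mulXsubC q0 ht.
  exists s', t'; split=> //.
  by case: h => h; [left|right]; apply/(interlaced_cons u);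
    [apply: interlaced_perm h|apply: interlaced_perm h].
exists (u :: s), (u :: t); split.
- exact: (zeros_ofM (zeros_of_XsubC u) hs).
- exact: (zeros_ofM (zeros_of_XsubC u) ht).
- by case: h => h; [left|right]; apply/interlaced_cons.
Qed.

Definition wronskian p q := p^`() * q - p * q^`().

Lemma wronskian_mul r p q : wronskian (r * p) (r * q) = r ^+ 2 * wronskian p q.
Proof. by rewrite /wronskian !derivM; ring. Qed.

Lemma wronskianDZ p q q' (c : R) :
  wronskian p (q + c *: q') = wronskian p q + c *: wronskian p q'.
Proof.
by rewrite /wronskian derivD derivZ -!mul_polyC; ring.
Qed.

(** Holds by continuity. It is needed when [(x - u)^2] is divided out of a Wronskian, which gives
    the sign only away from [u]. *)
Lemma poly_le0_punctured p u :
  (forall x, x != u -> p.[x] <= 0) -> forall x, p.[x] <= 0.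
Proof.
move=> h x; have [->|] := eqVneq x u; last exact: h.
rewrite leNgt; apply/negP => pu.
have u1 : p.[u + 1] <= 0 by apply: h; lra.
(* The value [p.[u] / 2] is attained strictly between [u] and [u + 1], so [p] is positive at a point
   other than [u]. *)
have [y] : {y | y \in `]u, u + 1[ & root (p - (p.[u] / 2)%:P) y}.
  apply: poly_ivtoo; first by lra.
  rewrite !hornerE; set A := p.[u] in pu *; set B := p.[u+1] in u1 *; nra.
rewrite in_itv /= => /andP [uy _]; rewrite rootE !hornerE subr_eq0 => /eqP py.
have := h y; rewrite py gt_eqF // => /(_ isT); lra.
Qed.

Lemma prec_mulXsubC u p q : p != 0 -> q != 0 ->
  prec (('X - u%:P) * p) (('X - u%:P) * q) <-> prec p q.
Proof.
move=> p0 q0; have X0 : 'X - u%:P != 0 :> {poly R} by rewrite polyXsubC_eq0.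
have ru : real_rooted ('X - u%:P).
  by exists [:: u]; apply: zeros_of_XsubC.
split=> -[rp rq h]; split.
- exact: real_rooted_mulXsubC rp.
- exact: real_rooted_mulXsubC rq.
- have [|/eqP|[zi w]] := h; first by move/eqP; rewrite mulf_eq0 (negPf X0) (negPf p0).
    by rewrite mulf_eq0 (negPf X0) (negPf q0).
  constructor 3; split; first by apply/(zeros_interlace_mulXsubC u p0 q0).
  apply: (@poly_le0_punctured _ u) => x xu.
  have := w x; rewrite -/(wronskian _ _) wronskian_mul hornerM pmulr_rle0 //.
  by rewrite horner_exp exprn_even_gt0 //= !hornerE subr_eq0.
- exact: real_rootedM.
- exact: real_rootedM.
- have [/eqP|/eqP|[zi w]] := h; [by rewrite (negPf p0)|by rewrite (negPf q0)|].
  constructor 3; split; first by apply/(zeros_interlace_mulXsubC u p0 q0).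
  move=> x; rewrite -/(wronskian _ _) wronskian_mul hornerM horner_exp.
  by rewrite mulr_ge0_le0 ?sqr_ge0 // w.
Qed.

(** The Wronskian is antisymmetric, so the sign of [q] compensates the exchange; for Pick functions
    this is invariance under [w |-> - 1 / w]. *)
Lemma prec_swap p q : prec p (- q) -> prec q p.
Proof.
case=> rp /real_rootedN; rewrite opprK => rq h; split=> //.
case: h => [->|/eqP|[[s [t [hs ht h]]] w]].
- by constructor 2.
- by rewrite oppr_eq0 => /eqP ->; constructor 1.
- constructor 3; split.
    exists t, s; split=> //; last by case: h; [right|left].
    by rewrite -[q]opprK; apply: zeros_ofN.
  have -> : q^`() * p - q * p^`() = p^`() * - q - p * (- q)^`().
    by rewrite derivN; ring.
  exact: w.
Qed.

End ZeroLists.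

(** * Pick functions and partial fractions *)

Section PickFunctions.
Variable R : realType.
Implicit Types (p q : {poly R}) (s bad : seq R) (r : seq (R * R)).
Implicit Types (w : R -> R) (al be u x z : R).

(** Entries of [r] are pairs of a pole and a weight. Poles may repeat, so adding two such functions
    only concatenates lists; [merge_poles] makes them distinct. *)
Definition pfrac al be r x := al * x + be - \sum_(i <- r) i.2 / (x - i.1).

(* The rational functions mapping the upper half-plane to its closure, taken
   modulo finitely many values, so that x / 0 = 0 at a pole is harmless. *)
Definition pick_fun w := exists al be r bad,
  [/\ 0 <= al, forall i, i \in r -> 0 <= i.2
    & forall x, x \notin bad -> w x = pfrac al be r x].

Lemma pick_fun_ext bad w1 w2 : (forall x, x \notin bad -> w1 x = w2 x) ->
  pick_fun w1 -> pick_fun w2.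
Proof.
move=> h [al [be [r [bad' [al0 r0 e]]]]].
exists al, be, r, (bad ++ bad'); split=> // x; rewrite mem_cat negb_or.
by move=> /andP [hb hb']; rewrite -h // e.
Qed.

Lemma pick_funD w1 w2 :
  pick_fun w1 -> pick_fun w2 -> pick_fun (fun x => w1 x + w2 x).
Proof.
move=> [al [be [r [bad [al0 r0 e]]]]] [al' [be' [r' [bad' [al0' r0' e']]]]].
exists (al + al'), (be + be'), (r ++ r'), (bad ++ bad'); split.
- exact: addr_ge0.
- by move=> i; rewrite mem_cat => /orP [/r0|/r0'].
- move=> x; rewrite mem_cat negb_or => /andP [hb hb'].
  by rewrite e // e' // /pfrac big_cat /=; ring.
Qed.

Lemma pick_fun_affine al be : 0 <= al -> pick_fun (fun x => al * x + be).
Proof.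
by move=> al0; exists al, be, [::], [::]; split=> // x _; rewrite /pfrac big_nil subr0.
Qed.

Lemma pick_fun_const be : pick_fun (fun=> be).
Proof.
apply: (@pick_fun_ext [::] (fun x => 0 * x + be)); last exact: pick_fun_affine.
by move=> x _; rewrite mul0r add0r.
Qed.

Lemma pick_fun_pole k z : 0 <= k -> pick_fun (fun x => - (k / (x - z))).
Proof.
move=> k0; exists 0, 0, [:: (z, k)], [::]; split=> // [i|x _].
  by rewrite inE => /eqP ->.
by rewrite /pfrac big_seq1 mul0r addr0 add0r.
Qed.

Lemma pick_fun_sum (T : eqType) (s : seq T) (f : T -> R -> R) :
  (forall i, i \in s -> pick_fun (f i)) -> pick_fun (fun x => \sum_(i <- s) f i x).
Proof.
elim: s => [|z s IH] h.
  by apply: (@pick_fun_ext [::] (fun=> 0)) (pick_fun_const 0) => x _; rewrite big_nil.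
apply: (@pick_fun_ext [::] (fun x => f z x + \sum_(y <- s) f y x)).
  by move=> x _; rewrite big_cons.
apply: pick_funD; first by apply: h; rewrite mem_head.
by apply: IH => y hy; apply: h; rewrite inE hy orbT.
Qed.

Lemma poly_eq_cofinite bad p q :
  (forall x, x \notin bad -> p.[x] = q.[x]) -> p = q.
Proof.
move=> h; apply/eqP; rewrite -subr_eq0; apply/negPn/negP => d0.
(* Multiplying the difference by a product that vanishes on [bad] gives a nonzero polynomial with
   value 0 everywhere. *)
have B0 : \prod_(z <- bad) ('X - z%:P) != 0 :> {poly R}.
  exact: monic_neq0 (monic_prod_XsubC _ _ _).
have D0 := mulf_neq0 d0 B0; set D := (_ * _) in D0.
have hD x : D.[x] = 0.
  rewrite /D hornerM; case: (boolP (x \in bad)) => hx.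
    have /eqP -> : (\prod_(z <- bad) ('X - z%:P)).[x] == 0.
      by rewrite -rootE root_prod_XsubC.
    exact: mulr0.
  by rewrite !hornerE h // subrr mul0r.
pose rs : seq R := [seq i%:R | i <- iota 0 (size D)].
suff : (size rs < size D)%N by rewrite size_map size_iota ltnn.
apply: (max_poly_roots D0).
  by apply/allP => x _; rewrite rootE hD.
by rewrite map_inj_uniq ?iota_uniq // => i j /eqP; rewrite eqr_nat => /eqP.
Qed.

Lemma finitely_many_roots p : p != 0 ->
  exists bad, forall x, x \notin bad -> p.[x] != 0.
Proof.
move=> p0; exists (rootsR p) => x; rewrite -(roots_on_rootsR p0) in_itv /=.
by rewrite rootE.
Qed.

(** * Cofactors and the normal form of a Pick function *)

Definition cofactor s z : {poly R} := \prod_(y <- s | y != z) ('X - y%:P).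

(** The numerator of [al x + be - sum c_z / (x - z)] over the common denominator [prod (x - z)]. *)
Definition pick_num al be (c : R -> R) s : {poly R} :=
  (al *: 'X + be%:P) * \prod_(z <- s) ('X - z%:P)
  - \sum_(z <- s) c z *: cofactor s z.

Lemma prod_XsubC_cofactor s z : uniq s -> z \in s ->
  \prod_(y <- s) ('X - y%:P) = ('X - z%:P) * cofactor s z.
Proof. by move=> us zs; rewrite (bigD1_seq z). Qed.

Lemma size_cofactor s z : uniq s -> z \in s -> size (cofactor s z) = size s.
Proof.
move=> us zs; apply/eqP; rewrite -eqSS -(size_prod_XsubC s id).
rewrite (prod_XsubC_cofactor us zs) size_mul ?size_XsubC ?polyXsubC_eq0 //.
by rewrite /cofactor -big_filter; apply: monic_neq0 (monic_prod_XsubC _ _ _).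
Qed.

Lemma horner_cofactor_neq0 s z : (cofactor s z).[z] != 0.
Proof.
rewrite -[_ == 0]rootE /cofactor -big_filter root_prod_XsubC mem_filter eqxx.
by [].
Qed.

Lemma horner_cofactor_other s y z : y \in s -> y != z -> (cofactor s z).[y] = 0.
Proof.
move=> ys yz; apply/eqP; rewrite -rootE /cofactor -big_filter root_prod_XsubC.
by rewrite mem_filter yz.
Qed.

Lemma horner_cofactor s z x : uniq s -> z \in s -> x \notin s ->
  (cofactor s z).[x] = (\prod_(y <- s) ('X - y%:P)).[x] / (x - z).
Proof.
move=> us zs xs; rewrite (prod_XsubC_cofactor us zs) hornerM hornerXsubC.
have xz : x - z != 0 by rewrite subr_eq0; apply: contraNneq xs => ->.
by rewrite mulrAC divff // mul1r.
Qed.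

Lemma horner_sum_cofactor s (f : R -> R) z : uniq s -> z \in s ->
  (\sum_(y <- s) f y *: cofactor s y).[z] = f z * (cofactor s z).[z].
Proof.
move=> us zs; rewrite (bigD1_seq z) //= hornerD hornerZ horner_sum big_seq_cond.
rewrite big1 ?addr0 // => y /andP [ys yz].
by rewrite hornerZ horner_cofactor_other ?mulr0 // eq_sym.
Qed.

Lemma horner_pick_num al be c s x : uniq s -> x \notin s ->
  (pick_num al be c s).[x] = (\prod_(z <- s) ('X - z%:P)).[x]
    * (al * x + be - \sum_(z <- s) c z / (x - z)).
Proof.
move=> us xs; rewrite /pick_num hornerD hornerM hornerN horner_sum mulrBr.
congr (_ - _); first by rewrite !hornerE mulrC.
rewrite mulr_sumr big_seq [RHS]big_seq; apply: eq_bigr => z zs.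
by rewrite hornerZ horner_cofactor // mulrCA.
Qed.

Lemma horner_pick_num_pole al be c s z : uniq s -> z \in s ->
  (pick_num al be c s).[z] = - c z * (cofactor s z).[z].
Proof.
move=> us zs; rewrite /pick_num hornerD hornerN horner_sum_cofactor // hornerM.
have /eqP -> : (\prod_(y <- s) ('X - y%:P)).[z] == 0.
  by rewrite -rootE root_prod_XsubC.
by rewrite mulr0 add0r mulNr.
Qed.

Lemma merge_poles r : (forall i, i \in r -> 0 <= i.2) ->
  exists s (c : R -> R), [/\ uniq s, forall z, z \in s -> 0 < c z
    & forall x, \sum_(i <- r) i.2 / (x - i.1) = \sum_(z <- s) c z / (x - z)].
Proof.
elim: r => [|[z k] r IH] h.
  by exists [::], (fun=> 0); split=> // x; rewrite !big_nil.
have [|s [c [us c0 e]]] := IH; first by move=> i hi; apply: h; rewrite inE hi orbT.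
have : 0 <= k by apply: (h (z, k)); rewrite mem_head.
rewrite le_eqVlt => /orP [/eqP <-|k0].
  by exists s, c; split=> // x; rewrite big_cons mul0r add0r e.
case: (boolP (z \in s)) => zs.
  exists s, (fun y => c y + if y == z then k else 0); split=> // [y hy|x].
    by have := c0 _ hy; case: ifP; lra.
  rewrite big_cons e /= (bigD1_seq z) //= [RHS](bigD1_seq z) //= eqxx addrA.
  congr (_ + _); first by rewrite mulrDl addrC.
  by apply: eq_bigr => y /negPf ->; rewrite addr0.
exists (z :: s), (fun y => if y == z then k else c y); split=> [|y|x].
- by rewrite /= zs.
- by rewrite inE; case: eqP => //= _; exact: c0.
- rewrite !big_cons e eqxx; congr (_ + _).
  by rewrite big_seq [RHS]big_seq; apply: eq_bigr => y ys; case: eqP => // yz;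
    rewrite -yz ys in zs.
Qed.

(** An identity off a finite set becomes a polynomial identity. At a pole [z] its left side
    vanishes, while [pick_num] is [- c z] times a nonzero cofactor value; hence [p] vanishes
    there. *)
Lemma pick_fun_normal p q : p != 0 -> pick_fun (fun x => q.[x] / p.[x]) ->
  exists al be s c, [/\ 0 <= al, sorted <%O s,
    forall z, z \in s -> 0 < c z, forall z, z \in s -> root p z
    & q * \prod_(z <- s) ('X - z%:P) = p * pick_num al be c s].
Proof.
move=> p0 [al [be [r [bad [al0 r0 e]]]]].
have [s' [c [us' c0' es']]] := merge_poles r0.
have [s [ss us c0 es]] : exists s, [/\ sorted <%O s, uniq s, forall z, z \in s -> 0 < c z &
    forall x, \sum_(i <- r) i.2 / (x - i.1) = \sum_(z <- s) c z / (x - z)].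
  exists (sort <=%O s'); split; rewrite ?sort_lt_sorted ?sort_uniq //.
    by move=> z; rewrite mem_sort; exact: c0'.
  by move=> x; rewrite es'; apply: perm_big; rewrite perm_sym; exact/permEl/perm_sort.
have id : q * \prod_(z <- s) ('X - z%:P) = p * pick_num al be c s.
  have [rp hrp] := finitely_many_roots p0.
  apply: (@poly_eq_cofinite (rp ++ bad ++ s)) => x.
  rewrite !mem_cat !negb_or => /and3P [xp xb xs].
  rewrite !hornerM horner_pick_num // -es -/(pfrac _ _ _ _) -e //.
  by have := hrp _ xp; move=> px; field.
exists al, be, s, c; split=> // z zs.
have /(congr1 (fun g => g.[z])) := id.
rewrite !hornerM horner_pick_num_pole //.
have /eqP -> : (\prod_(y <- s) ('X - y%:P)).[z] == 0.
  by rewrite -rootE root_prod_XsubC.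
rewrite mulr0 rootE => /esym/eqP; rewrite mulf_eq0 => /orP [//|].
by rewrite mulNr oppr_eq0 mulf_eq0 (negPf (horner_cofactor_neq0 _ _)) gt_eqF ?c0.
Qed.

End PickFunctions.

(** * From interlacing to partial fractions *)

Section PrecPick.
Variable R : realType.
Implicit Types (p q : {poly R}) (s : seq R) (u x z : R).

(** Lagrange interpolation: the difference vanishes at all nodes and is too small for that many
    roots. *)
Lemma cofactor_interpolation s p : uniq s -> (size p <= size s)%N ->
  p = \sum_(z <- s) (p.[z] / (cofactor s z).[z]) *: cofactor s z.
Proof.
move=> us sp; apply/eqP; rewrite -subr_eq0; apply/negPn/negP.
set D := p - _ => D0; have aD : all (root D) s.
  apply/allP => z zs; rewrite rootE hornerD hornerN.
  rewrite (horner_sum_cofactor (fun z => p.[z] / (cofactor s z).[z])) //.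
  by rewrite divfK ?horner_cofactor_neq0 // subrr.
have := max_poly_roots D0 aD us; rewrite ltnNge => /negP; apply.
apply: leq_trans (size_polyD _ _) _; rewrite geq_max sp size_polyN.
rewrite big_seq; apply: (big_ind (fun g : {poly R} => (size g <= size s)%N)).
- by rewrite size_poly0.
- by move=> g h hg hh; apply: leq_trans (size_polyD _ _) _; rewrite geq_max hg.
- by move=> z zs; apply: leq_trans (size_scale_leq _ _) _; rewrite size_cofactor.
Qed.

Lemma deriv_prod_XsubC s z : uniq s -> z \in s ->
  (\prod_(y <- s) ('X - y%:P))^`().[z] = (cofactor s z).[z].
Proof.
move=> us zs; rewrite (prod_XsubC_cofactor us zs) derivM derivXsubC mul1r.
by rewrite hornerD hornerM hornerXsubC subrr mul0r addr0.
Qed.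

(** The Wronskian is [- k_1 p^2 + W(p, r)], where the first term dominates if [k_1] is nonzero; a
    negative [k_1] would make it positive near infinity. *)
Lemma wronskian_le0_lead p q (k r : {poly R}) : p != 0 -> q = k * p + r ->
  (size k <= 2)%N -> (size r < size p)%N ->
  (forall x, (wronskian p q).[x] <= 0) -> 0 <= k`_1.
Proof.
move=> p0 eq sk sr w; rewrite leNgt; apply/negP => k1.
have ek : k = k`_1 *: 'X + (k`_0)%:P.
  apply/polyP => i; rewrite coefD coefZ coefX coefC.
  case: i => [|[|i]] /=; rewrite ?mulr0 ?mulr1 ?add0r ?addr0 //.
  by apply: nth_default; apply: leq_trans sk _.
have dk : k^`() = (k`_1)%:P.
  by rewrite {1}ek derivD derivZ derivX derivC addr0 alg_polyC.
have eW : wronskian p q = (- k`_1) *: p ^+ 2 + wronskian p r.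
  by rewrite /wronskian eq derivD derivM dk -mul_polyC polyCN; ring.
have sW : (size (wronskian p r) < size ((- k`_1) *: p ^+ 2))%N.
  rewrite size_scale ?oppr_eq0 ?lt_eqF // expr2 size_mul //.
  have sp : (0 < size p)%N by rewrite size_poly_gt0.
  have h1 : (size (p^`() * r)%R <= (size p + size p).-2)%N.
    apply: leq_trans (size_polyMleq _ _) _.
    have := lt_size_deriv p0; lia.
  have h2 : (size (p * r^`())%R <= (size p + size p).-2)%N.
    apply: leq_trans (size_polyMleq _ _) _.
    have : (size r^`()%R <= (size r).-1)%N by exact: size_poly.
    lia.
  apply: (@leq_ltn_trans (size p + size p).-2); last first.
    have aux n : (0 < n -> (n + n).-2 < (n + n).-1)%N by lia.
    exact: aux sp.
  by apply: leq_trans (size_polyD _ _) _; rewrite size_polyN geq_max h1.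
have lW : lead_coef (wronskian p q) = - k`_1 * lead_coef p ^+ 2.
  by rewrite eW lead_coefDl // lead_coefZ lead_coef_exp.
have lW0 : 0 < lead_coef (wronskian p q).
  rewrite lW mulr_gt0 ?oppr_gt0 // lt_neqAle sqr_ge0 andbT eq_sym.
  by rewrite expf_neq0 // lead_coef_eq0.
have [n hn] := poly_pinfty_gt_lc lW0.
by have := le_trans (hn n (lexx _)) (w n); rewrite leNgt lW0.
Qed.

(** Division by [p] leaves an affine quotient, whose slope is handled by [wronskian_le0_lead], and a
    remainder interpolated at the zeros of [p]. The residue at a zero [z] has the sign of
    [p'(z) q(z)], which is the Wronskian there. *)
Lemma prec_pick_coprime p q : p != 0 -> q != 0 ->
  (forall u, root p u -> ~~ root q u) -> prec p q ->
  pick_fun (fun x => q.[x] / p.[x]).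
Proof.
move=> p0 q0 cpq [_ _ h].
case: h => [/eqP|/eqP|[[s [t [hs ht al]]] w]]; first by rewrite (negPf p0).
  by rewrite (negPf q0).
have neq_st i j : (i < size s)%N -> (j < size t)%N -> s`_i != t`_j.
  move=> hi hj; apply/negP => /eqP e; move: (cpq s`_i).
  by rewrite (root_zeros _ p0 hs) (root_zeros _ q0 ht) mem_nth // e mem_nth // => /(_ isT).
(* Between consecutive zeros of [p] lies a zero of [q], distinct from both; hence the zeros of [p]
   are simple. *)
have [us st] : uniq s /\ (size t <= (size s).+1)%N.
  case: al => [[/andP [sz1 sz2] h1 h2]|[/andP [sz1 sz2] h1 h2]].
    split; last exact: leq_trans sz1 (leqnSn _).
    apply: (@sorted_uniq _ <%O lt_trans ltxx); apply/(sortedP 0) => i hi.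
    have hit : (i < size t)%N by rewrite -ltnS; exact: leq_trans hi sz2.
    apply: lt_le_trans (h2 i hi).
    by rewrite lt_neqAle h1 // neq_st // ltnW.
  split=> //; apply: (@sorted_uniq _ <%O lt_trans ltxx); apply/(sortedP 0) => i hi.
  have hit : (i.+1 < size t)%N by exact: leq_trans hi sz1.
  apply: le_lt_trans (h2 i hit) _.
  by rewrite lt_neqAle h1 // eq_sym neq_st // ltnW.
pose P : {poly R} := \prod_(z <- s) ('X - z%:P).
have eP : p = lead_coef p *: P by exact: hs.
have lp0 : lead_coef p != 0 by rewrite lead_coef_eq0.
pose k := q %/ p; pose r := q %% p.
have eq : q = k * p + r by exact: divp_eq.
have sr : (size r < size p)%N by rewrite ltn_modp.
have sk : (size k <= 2)%N.
  by rewrite size_divp // (size_zeros p0 hs) (size_zeros q0 ht) /= leq_subLR addn2.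
have k1 := wronskian_le0_lead p0 eq sk sr w.
have ek x : k.[x] = k`_1 * x + k`_0.
  rewrite (horner_coef_wide _ sk) big_ord_recr big_ord1 /= expr0 expr1 mulr1.
  by rewrite addrC.
have er := cofactor_interpolation us (_ : (size r <= size s)%N).
have {}er := er _; rewrite (size_zeros p0 hs) ltnS in sr; have {}er := er sr.
pose f z x := - (- (r.[z] / (cofactor s z).[z] / lead_coef p) / (x - z)).
apply: (@pick_fun_ext _ s (fun x => k`_1 * x + k`_0 + \sum_(z <- s) f z x)).
  move=> x xs; rewrite eq hornerD hornerM ek mulrDl.
  have px : p.[x] != 0 by rewrite -[_ == 0]rootE (root_zeros x p0 hs).
  rewrite mulfK //; congr (_ + _); rewrite {1}er horner_sum mulr_suml.
  rewrite big_seq [RHS]big_seq; apply: eq_bigr => z zs.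
  rewrite hornerZ [(cofactor s z).[x]]horner_cofactor // -/P.
  have Px : P.[x] != 0 by rewrite -[_ == 0]rootE root_prod_XsubC.
  have xz : x - z != 0 by rewrite subr_eq0; apply: contraNneq xs => ->.
  have c0 := horner_cofactor_neq0 s z.
  have epx : p.[x] = lead_coef p * P.[x] by rewrite {1}eP hornerZ.
  rewrite /f epx; field.
  by rewrite c0 lp0 Px xz.
apply: pick_funD; first exact: pick_fun_affine.
apply: pick_fun_sum => z zs; apply: pick_fun_pole.
have c0 := horner_cofactor_neq0 s z.
have pz : p.[z] = 0 by apply/eqP; rewrite -rootE (root_zeros z p0 hs).
have rz : r.[z] = q.[z] by rewrite eq hornerD hornerM pz mulr0 add0r.
have := w z; rewrite hornerD hornerN !hornerM pz mul0r subr0 {1}eP derivZ hornerZ.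
rewrite deriv_prod_XsubC // -rz; set C := (cofactor s z).[z] in c0 *.
have CL : C * lead_coef p != 0 by rewrite mulf_neq0.
rewrite oppr_ge0 => hw.
(* The residue is the Wronskian at [z] divided by the square of [p'(z)]. *)
have -> : r.[z] / C / lead_coef p =
  (lead_coef p * C * r.[z]) * (C * lead_coef p)^-2 by field; rewrite c0 lp0.
by rewrite mulr_le0_ge0 // invr_ge0 sqr_ge0.
Qed.

Lemma common_root_or_coprime p q : p != 0 ->
  (exists2 u, root p u & root q u) \/ (forall u, root p u -> ~~ root q u).
Proof.
move=> p0; case: (boolP (has (root q) (rootsR p))) => [/hasP [u]|/hasPn h].
  by rewrite -(roots_on_rootsR p0) in_itv => pu qu; left; exists u.
by right=> u pu; apply: h; rewrite -(roots_on_rootsR p0) in_itv.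
Qed.

(** Common zeros are cancelled one at a time; the quotient changes at most in its value at the
    cancelled zero. *)
Lemma prec_pick p q : p != 0 -> prec p q -> pick_fun (fun x => q.[x] / p.[x]).
Proof.
have [n] := ubnP (size p); elim: n => // n IH in p q *; rewrite ltnS => sp p0 h.
have [->|q0] := eqVneq q 0.
  by apply: (@pick_fun_ext _ [::] (fun=> 0)) (pick_fun_const 0) => x _;
    rewrite horner0 mul0r.
have [[u /factor_theorem [p1 ep] /factor_theorem [q1 eq]]|c] :=
  common_root_or_coprime q p0; last exact: prec_pick_coprime.
have p10 : p1 != 0 by apply: contraNneq p0 => e; rewrite ep e mul0r.
have q10 : q1 != 0 by apply: contraNneq q0 => e; rewrite eq e mul0r.
apply: (@pick_fun_ext _ [:: u] (fun x => q1.[x] / p1.[x])).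
  move=> x; rewrite inE => xu; rewrite ep eq !hornerM hornerXsubC.
  by rewrite -mulf_div divff ?mulr1 // subr_eq0.
apply: IH => //; last first.
  by apply/(prec_mulXsubC u p10 q10); rewrite mulrC -ep mulrC -eq.
by rewrite ep size_mul ?size_XsubC ?polyXsubC_eq0 // addnC in sp.
Qed.

End PrecPick.

(** * From partial fractions to interlacing *)

Section PickPrec.
Variable R : realType.
Implicit Types (p q : {poly R}) (s l t : seq R) (u x y z : R).

Lemma prod_XsubC_same_side s (P : pred R) (a b : R) :
  (forall x, x \in s -> P x -> 0 < (a - x) * (b - x)) ->
  0 < (\prod_(x <- s | P x) ('X - x%:P)).[a]
      * (\prod_(x <- s | P x) ('X - x%:P)).[b].
Proof.
move=> h; rewrite big_seq_cond; apply: (big_rec (fun g : {poly R} => 0 < g.[a] * g.[b])).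
  by rewrite !hornerE.
move=> x g /andP [xs Px] hg; rewrite !hornerM !hornerXsubC mulrACA.
by apply: mulr_gt0 hg; apply: h.
Qed.

(** The factors [y - z] and [z - y] have opposite signs; every other factor has the same sign at the
    neighbouring nodes [y] and [z]. *)
Lemma cofactor_opposite_signs s y z : uniq s -> y \in s -> z \in s -> y < z ->
  (forall x, x \in s -> x <= y \/ z <= x) ->
  (cofactor s y).[y] * (cofactor s z).[z] < 0.
Proof.
move=> us ys zs yz h; pose P x := (x != y) && (x != z).
have cy : cofactor s y = ('X - z%:P) * \prod_(x <- s | P x) ('X - x%:P).
  rewrite /cofactor -big_filter (bigD1_seq z) ?filter_uniq ?mem_filter ?zs ?gt_eqF //=.
  by rewrite big_filter_cond.
have cz : cofactor s z = ('X - y%:P) * \prod_(x <- s | P x) ('X - x%:P).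
  rewrite /cofactor -big_filter (bigD1_seq y) ?filter_uniq ?mem_filter ?ys ?lt_eqF //=.
  by rewrite big_filter_cond; congr (_ * _); apply: eq_bigl => x; rewrite andbC.
have := @prod_XsubC_same_side s P y z.
rewrite cy cz !hornerM !hornerXsubC mulrACA => /(_ _) hp.
rewrite nmulr_rlt0; last by nra.
apply: hp => x xs /andP [xy xz]; case: (h x xs) => hx.
  have xy' : x < y by rewrite lt_neqAle xy.
  by nra.
have xz' : z < x by rewrite lt_neqAle eq_sym xz.
by nra.
Qed.

Lemma prod_XsubC_cofactor_sign s x z : uniq s -> z \in s ->
  (forall y, y \in s -> y != z -> 0 < (x - y) * (z - y)) ->
  exists2 k, 0 < k &
    (\prod_(y <- s) ('X - y%:P)).[x] * (cofactor s z).[z] = (x - z) * k.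
Proof.
move=> us zs h; exists ((cofactor s z).[x] * (cofactor s z).[z]).
  exact: prod_XsubC_same_side.
by rewrite (prod_XsubC_cofactor us zs) hornerM hornerXsubC mulrA.
Qed.

Lemma sum_poles_small s (c : R -> R) (e : R) : 0 < e ->
  (forall z, z \in s -> 0 < c z) -> exists K, forall x, K <= x ->
    (forall z, z \in s -> z < x) /\ \sum_(z <- s) c z / (x - z) < e.
Proof.
elim: s e => [|z s IH] e e0 c0.
  by exists 0 => x _; split=> //; rewrite big_nil.
have [||K hK] := IH (e / 2); first by lra.
  by move=> y hy; apply: c0; rewrite inE hy orbT.
have cz : 0 < c z by apply: c0; rewrite mem_head.
(* Beyond [z + c z * 2 / e] the new term is at most [e / 2]. *)
exists (Num.max K (z + c z * 2 / e)) => x; rewrite ge_max => /andP [/hK [h1 h2] h3].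
have k0 : 0 < c z * 2 / e by rewrite divr_gt0 ?mulr_gt0.
have zx : z < x by lra.
split=> [y|]; first by rewrite inE => /orP [/eqP ->|/h1].
rewrite big_cons [ltRHS]splitr; apply: ler_ltD h2.
rewrite ler_pdivrMr ?subr_gt0 //.
have : c z * 2 / e <= x - z by lra.
rewrite ler_pdivrMr //; lra.
Qed.

Lemma pfrac_pos_right s c al be : (forall z, z \in s -> 0 < c z) ->
  0 < al \/ al = 0 /\ 0 < be ->
  exists x, (forall z, z \in s -> z < x)
    /\ 0 < al * x + be - \sum_(z <- s) c z / (x - z).
Proof.
move=> c0 [al0|[-> be0]].
  have [K hK] := sum_poles_small (@ltr01 R) c0.
  pose x := Num.max K ((1 - be) / al).
  have [|h1 h2] := hK x; first by rewrite le_max lexx.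
  exists x; split=> //.
  have : (1 - be) / al <= x by rewrite le_max lexx orbT.
  rewrite ler_pdivrMr //; lra.
have [K hK] := sum_poles_small be0 c0.
have [h1 h2] := hK K (lexx _).
by exists K; split=> //; lra.
Qed.

(** Reflection: [- w(-x)] has the same slope and weights, constant [- be] and poles [- z]. *)
Lemma pfrac_neg_left s c al be : (forall z, z \in s -> 0 < c z) ->
  0 < al \/ al = 0 /\ be < 0 ->
  exists x, (forall z, z \in s -> x < z)
    /\ al * x + be - \sum_(z <- s) c z / (x - z) < 0.
Proof.
move=> c0 h.
have c0' z : z \in [seq - y | y <- s] -> 0 < c (- z).
  by move=> /mapP [y ys ->]; rewrite opprK; exact: c0.
have [|x [h1 h2]] := @pfrac_pos_right _ (fun z => c (- z)) al (- be) c0'.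
  by case: h => [|[-> be0]]; [left|right; rewrite oppr_gt0].
exists (- x); split=> [z zs|].
  by rewrite ltrNl; apply: h1; apply: map_f.
move: h2; rewrite big_map.
have -> : \sum_(j <- s) c (- - j) / (x - - j) = - \sum_(z <- s) c z / (- x - z).
  rewrite -sumrN; apply: eq_bigr => z _; rewrite opprK -mulrN -invrN opprB.
  by rewrite opprK addrC.
lra.
Qed.

Lemma ivt_chain q l :
  sorted (fun y z => (y < z) && (q.[y] * q.[z] < 0)) l ->
  exists t, size t = (size l).-1 /\ forall i, (i < size t)%N ->
    [/\ l`_i < t`_i, t`_i < l`_i.+1 & root q t`_i].
Proof.
elim: l => [|y [|z l] IH]; first by exists [::].
  by exists [::].
move=> /= /andP [/andP [yz q0] /IH [t [st ht]]].
have [x] := poly_ivtoo (ltW yz) q0; rewrite in_itv /= => /andP [yx xz] qx.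
exists (x :: t); split; first by rewrite /= st.
by case=> [//|i] hi; apply: ht.
Qed.

(** The roots found are distinct, and the size of [q] leaves room for no others. *)
Lemma zeros_of_chain q l t : q != 0 -> size t = (size l).-1 ->
  (forall i, (i < size t)%N -> [/\ l`_i < t`_i, t`_i < l`_i.+1 & root q t`_i]) ->
  (size q <= (size t).+1)%N -> zeros_of q t.
Proof.
move=> q0 st ht sq.
have rt : all (root q) t by apply/(all_nthP 0) => i /ht [].
have ut : uniq t.
  apply: (@sorted_uniq _ <%O lt_trans ltxx); apply/(sortedP 0) => i hi.
  have [_ h1 _] := ht i (ltnW hi); have [h2 _ _] := ht _ hi.
  exact: lt_trans h1 h2.
apply: all_roots_prod_XsubC => //; last by rewrite uniq_rootsE.
by apply/eqP; rewrite eqn_leq sq (max_poly_roots q0).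
Qed.

Lemma sorted_consI (T : Type) (e : rel T) (s : seq T) (x : T) :
  sorted e s -> (forall (z : T) (s' : seq T), s = z :: s' -> e x z) -> sorted e (x :: s).
Proof. by case: s => [//|z s'] /= es h; rewrite (h z s'). Qed.

Lemma sorted_rconsI (T : Type) (e : rel T) (s : seq T) (x : T) :
  sorted e s -> (forall (z : T) (s' : seq T), s = rcons s' z -> e z x) -> sorted e (rcons s x).
Proof.
case: s => [//|z s'] /= es h; rewrite rcons_path es.
by apply: (h _ (belast z s')); rewrite -lastI.
Qed.

(** * The numerator of a normal form interlaces its denominator *)

Section PartialFractions.
Variables (al be : R) (c : R -> R) (s : seq R).
Hypotheses (al0 : 0 <= al) (ss : sorted <%O s)
  (c0 : forall z, z \in s -> 0 < c z).

Let P : {poly R} := \prod_(z <- s) ('X - z%:P).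
Let N : {poly R} := pick_num al be c s.
Let us : uniq s := lt_sorted_uniq ss.

(** Each cofactor [C] satisfies [W(P, C) = C^2], so the Wronskian is minus a nonnegative combination
    of squares. *)
Lemma wronskian_pick_num x : (wronskian P N).[x] <= 0.
Proof.
have wc z : z \in s -> wronskian P (cofactor s z) = cofactor s z ^+ 2.
  move=> zs; rewrite /wronskian /P (prod_XsubC_cofactor us zs) derivM derivXsubC.
  by ring.
have -> : wronskian P N
    = - (al *: P ^+ 2 + \sum_(z <- s) c z *: cofactor s z ^+ 2).
  transitivity (- (al *: P ^+ 2) - \sum_(z <- s) c z *: wronskian P (cofactor s z)).
    rewrite /N /pick_num -/P.
    have -> : wronskian P ((al *: 'X + be%:P) * P - \sum_(z <- s) c z *: cofactor s z)
      = wronskian P ((al *: 'X + be%:P) * P)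
        - wronskian P (\sum_(z <- s) c z *: cofactor s z).
      by rewrite /wronskian derivB; ring.
    congr (_ - _).
      by rewrite /wronskian derivM derivD derivZ derivX derivC addr0 -!mul_polyC; ring.
    (* The cofactors refer to the whole list, so they are generalized to an arbitrary family before
       inducting on the range of the sum. *)
    elim: (s) (cofactor s) => [|z r IH] f.
      by rewrite !big_nil /wronskian deriv0 !mulr0 subr0.
    by rewrite !big_cons addrC wronskianDZ IH addrC.
  rewrite opprD; congr (_ - _); rewrite big_seq [RHS]big_seq.
  by apply: eq_bigr => z zs; rewrite wc.
rewrite hornerN oppr_le0 hornerD hornerZ horner_exp horner_sum addr_ge0 //.
  by rewrite mulr_ge0 ?sqr_ge0.
rewrite big_seq sumr_ge0 // => z zs.
by rewrite hornerZ horner_exp mulr_ge0 ?sqr_ge0 // ltW ?c0.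
Qed.

(** Booleans count as 0 or 1: a nonzero slope adds two to the number of poles, a nonzero constant
    alone adds one. *)
Lemma size_pick_num : (size N <= size s + (al != 0)%R + ((al != 0)%R || (be != 0)%R))%N.
Proof.
apply: leq_trans (size_polyD _ _) _; rewrite geq_max; apply/andP; split.
  have [a0|a0] /= := eqVneq al 0; last first.
    apply: leq_trans (size_polyMleq _ _) _; rewrite size_prod_XsubC.
    have -> : size (al *: 'X + be%:P) = 2%N.
      by rewrite -mul_polyC size_MXaddC polyC_eq0 (negPf a0) /= size_polyC a0.
    by rewrite add2n /= !addn1.
  rewrite a0 scale0r add0r; have [->|b0] := eqVneq be 0.
    by rewrite mul0r size_poly0.
  by rewrite mul_polyC size_scale // size_prod_XsubC addn0 addn1.
rewrite size_polyN big_seq; apply: (@leq_trans (size s)); last by rewrite -addnA leq_addr.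
apply: (big_ind (fun g : {poly R} => (size g <= size s)%N)).
- by rewrite size_poly0.
- by move=> g h hg hh; apply: leq_trans (size_polyD _ _) _; rewrite geq_max hg.
- by move=> z zs; apply: leq_trans (size_scale_leq _ _) _; rewrite size_cofactor.
Qed.

Let e y z := (y < z) && (N.[y] * N.[z] < 0).

Lemma pick_num_sign_poles : sorted e s.
Proof.
apply/(sortedP 0) => i hi.
have i1 : s`_i \in s by rewrite mem_nth // ltnW.
have i2 : s`_i.+1 \in s by rewrite mem_nth.
have lti : s`_i < s`_i.+1 by move/(sortedP 0): ss; apply.
rewrite /e lti /N !horner_pick_num_pole // mulrACA mulrNN.
rewrite pmulr_rlt0 ?mulr_gt0 ?c0 //.
apply: cofactor_opposite_signs => // x /(nthP 0) [j hj <-].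
have sm := lt_sorted_leq_nth 0 ss.
have [ji|ij] := leqP j i; [left|right]; rewrite sm ?inE //; exact: ltnW.
Qed.

(** Left of all poles [N = P w], and at the first pole [N] is [- c z] times the cofactor value. That
    value and [P.[x]] have opposite signs, so [w < 0] at [x] forces a sign change. *)
Lemma pick_num_sign_left x z s' : s = z :: s' -> (forall y, y \in s -> x < y) ->
  al * x + be - \sum_(z <- s) c z / (x - z) < 0 -> e x z.
Proof.
move=> es hx wx.
have zs : z \in s by rewrite es mem_head.
have xs : x \notin s by apply/negP => /hx; rewrite ltxx.
have xz := hx z zs; rewrite /e xz /N horner_pick_num // horner_pick_num_pole //.
have [|k k0 ek] := @prod_XsubC_cofactor_sign s x z us zs.
  move=> y ys yz; have := hx y ys.
  have : z < y.
    move: ss ys; rewrite es /= lt_path_sortedE inE (negPf yz) /= => /andP [/allP h _].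
    by move=> /h.
  by nra.
set w := (X in _ * X * _ < 0) in wx *; set Px := (_.[x]) in ek *.
have -> : Px * w * (- c z * (cofactor s z).[z]) = - (c z * w) * (Px * (cofactor s z).[z]).
  by ring.
have cw : 0 < - (c z * w) by rewrite oppr_gt0 pmulr_rlt0 ?c0.
by rewrite ek pmulr_rlt0 // pmulr_llt0 // subr_lt0.
Qed.

Lemma pick_num_sign_right x z s' : s = rcons s' z -> (forall y, y \in s -> y < x) ->
  0 < al * x + be - \sum_(z <- s) c z / (x - z) -> e z x.
Proof.
move=> es hx wx.
have zs : z \in s by rewrite es mem_rcons mem_head.
have xs : x \notin s by apply/negP => /hx; rewrite ltxx.
have xz := hx z zs; rewrite /e xz /N horner_pick_num_pole // horner_pick_num //.
have [|k k0 ek] := @prod_XsubC_cofactor_sign s x z us zs.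
  move=> y ys yz; have := hx y ys.
  have : y < z.
    (* Reversal turns the last entry into the head, which a sorted path compares with all others. *)
    have := ss; rewrite es -[rcons _ _]revK rev_rcons rev_sorted /=.
    rewrite (path_sortedE (rev_trans lt_trans)) => /andP [/allP h _].
    by move: ys; rewrite es mem_rcons inE (negPf yz) /= => ys; apply: h; rewrite mem_rev.
  by nra.
set w := (X in 0 < X) in wx *; set Px := ((\prod_(_ <- _) _).[x]) in ek *.
have -> : - c z * (cofactor s z).[z] * (Px * w) = - (c z * w) * (Px * (cofactor s z).[z]).
  by ring.
have cw : - (c z * w) < 0 by rewrite oppr_lt0 mulr_gt0 ?c0.
by rewrite ek nmulr_rlt0 // mulr_gt0 // subr_gt0.
Qed.

(** Neighbouring poles enclose zeros of [N]. If there are poles, a positive slope adds one zero on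
    each side of them, and a zero slope one on the side given by the sign of [be], or none if
    [be = 0]; [size_pick_num] excludes more. *)
Lemma pick_num_interlace : N != 0 -> zeros_interlace P N.
Proof.
move=> N0; have hP : zeros_of P s.
  by rewrite /zeros_of /P (monicP (monic_prod_XsubC _ _ _)) scale1r.
have pickr : 0 < al \/ al = 0 /\ 0 < be -> exists x, (forall z, z \in s -> z < x)
    /\ 0 < al * x + be - \sum_(z <- s) c z / (x - z) by exact: pfrac_pos_right.
have pickl : 0 < al \/ al = 0 /\ be < 0 -> exists x, (forall z, z \in s -> x < z)
    /\ al * x + be - \sum_(z <- s) c z / (x - z) < 0 by exact: pfrac_neg_left.
have sN := size_pick_num; have se := pick_num_sign_poles.
(* When w has a zero to the right of all the poles, a sentinel x with w x > 0
   there makes it visible as a sign change; symmetrically on the left. *)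
have se_right x : (forall z, z \in s -> z < x) ->
    0 < al * x + be - \sum_(z <- s) c z / (x - z) -> sorted e (rcons s x).
  by move=> hx wx; apply: sorted_rconsI => // z s' es; exact: pick_num_sign_right es hx wx.
have se_left x : (forall z, z \in s -> x < z) ->
    al * x + be - \sum_(z <- s) c z / (x - z) < 0 -> sorted e (x :: s).
  by move=> hx wx; apply: sorted_consI => // z s' es; exact: pick_num_sign_left es hx wx.
have zeros_between l : sorted e l -> (size N <= size l)%N ->
    exists t, [/\ zeros_of N t, (size t).+1 = size l &
      forall i, (i < size t)%N -> l`_i < t`_i /\ t`_i < l`_i.+1].
  move=> el sl; have [t [st ht]] := ivt_chain el.
  have l0 : (0 < size l)%N by apply: leq_trans sl; rewrite size_poly_gt0.
  have st1 : (size t).+1 = size l by rewrite st prednK.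
  exists t; split=> // [|i /ht []] //.
  by apply: (zeros_of_chain N0 st ht); rewrite st1.
move: al0; rewrite le_eqVlt => /orP [/eqP a0|al_gt0]; last first.
  have [xr [hr wr]] := pickr (or_introl al_gt0).
  have [xl [hl wl]] := pickl (or_introl al_gt0).
  have [||t [zt st ht]] := zeros_between (xl :: rcons s xr).
  - apply: sorted_consI => [|z s']; first exact: se_right.
    (* Without poles the two sentinels are neighbours, and the sign change is that of the affine
       function. *)
    case es: {1}s (se_left _ hl wl) => [|y s''] /=; last first.
      rewrite es /= => /andP [h _] [<- _]; exact: h.
    have Ns x : N.[x] = al * x + be.
      by rewrite /N horner_pick_num // es // !big_nil hornerC mul1r subr0.
    move: wl wr; rewrite es !big_nil !subr0 => wl wr _ [<- _].
    rewrite /e !Ns; apply/andP; split; last by rewrite pmulr_llt0.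
    by rewrite -(ltr_pM2l al_gt0); lra.
  - apply: leq_trans sN _; rewrite /= size_rcons gt_eqF //= !addn1 //.
  move: st; rewrite /= size_rcons => -[st].
  exists s, t; split=> //; right; split.
  - by rewrite st leqnSn leqnn.
  - move=> i hi; have [|_] := ht i; first by rewrite st ltnW.
    by rewrite /= nth_rcons hi => /ltW.
  - move=> i hi; have [h _] := ht _ hi; move: hi h.
    by rewrite st ltnS /= nth_rcons => -> /ltW.
have sN' : (size N <= size s + (be != 0)%R)%N.
  by move: sN; rewrite -a0 eqxx addn0.
case: (ltgtP be 0) => [b0|b0|b0].
- have [xl [hl wl]] := pickl (or_intror (conj (esym a0) b0)).
  have [||t [zt st ht]] := zeros_between (xl :: s); first exact: se_left.
    by apply: leq_trans sN' _; rewrite lt_eqF //= addn1.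
  move: st => -[st]; exists s, t; split=> //; right; split.
  - by rewrite st leqnSn leqnn.
  - by move=> i hi; have [|_ /ltW] := ht i; rewrite ?st.
  - by move=> i hi; have [/ltW] := ht _ hi.
- have [xr [hr wr]] := pickr (or_intror (conj (esym a0) b0)).
  have [||t [zt st ht]] := zeros_between (rcons s xr); first exact: se_right.
    by apply: leq_trans sN' _; rewrite size_rcons gt_eqF //= addn1.
  move: st; rewrite size_rcons => -[st]; exists s, t; split=> //; left; split.
  - by rewrite st leqnSn leqnn.
  - by move=> i hi; have [/ltW] := ht _ hi; rewrite nth_rcons -st hi.
  - move=> i hi; have [|_ /ltW] := ht i; first by rewrite st ltnW.
    by rewrite nth_rcons hi.
- have [|t [zt st ht]] := zeros_between s se.
    by apply: leq_trans sN' _; rewrite b0 eqxx addn0.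
  exists s, t; split=> //; left; split.
  - by rewrite -st leqnSn leqnn.
  - by move=> i hi; have [/ltW] := ht _ hi.
  - by move=> i; rewrite -st ltnS => hi; have [_ /ltW] := ht _ hi.
Qed.

End PartialFractions.
End PickPrec.

(** * The Pick criterion for interlacing and the rules it yields *)

Section PrecCriterion.
Variable R : realType.
Implicit Types (p q : {poly R}) (s : seq R) (u x y z : R).

Lemma coprimep_prod_XsubC q s : (forall z, z \in s -> ~~ root q z) ->
  coprimep (\prod_(z <- s) ('X - z%:P)) q.
Proof.
elim: s => [|z s IH] h; first by rewrite big_nil coprime1p.
rewrite big_cons coprimepMl coprimep_sym coprimep_XsubC h ?mem_head //=.
by apply: IH => y hy; apply: h; rewrite inE hy orbT.
Qed.

Lemma zeros_ofZ k p s : zeros_of p s -> zeros_of (k *: p) s.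
Proof. by rewrite /zeros_of lead_coefZ -scalerA => {1}->. Qed.

(** From [q P = p N] and coprimality [p] divides [P]; conversely the poles are distinct zeros of
    [p]. So [p] and [q] are the same constant multiple of [P] and [N]. *)
Lemma pick_prec_coprime p q : p != 0 -> q != 0 -> real_rooted p ->
  (forall u, root p u -> ~~ root q u) ->
  pick_fun (fun x => q.[x] / p.[x]) -> prec p q.
Proof.
move=> p0 q0 [s0 hs0] cpq /(pick_fun_normal p0) [al [be [s [c [al0 ss c0 rs id]]]]].
set P := \prod_(z <- s) _ in id; set N := pick_num _ _ _ _ in id.
have dpP : p %| P.
  have cpq' : coprimep p q.
    rewrite hs0 coprimepZl ?lead_coef_eq0 //; apply: coprimep_prod_XsubC => z zs.
    by apply: cpq; rewrite (root_zeros z p0 hs0).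
  by rewrite -(Gauss_dvdpr _ cpq') id dvdp_mulr.
have dPp : P %| p.
  apply: uniq_roots_dvdp; first exact/allP.
  by rewrite uniq_rootsE lt_sorted_uniq.
have /eqpf_eq [k k0 ek] : p %= P by apply/andP.
have P0 : P != 0 by apply: monic_neq0 (monic_prod_XsubC _ _ _).
have eq : q = k *: N.
  by apply: (mulIf P0); rewrite id ek -!scalerAl mulrC.
have N0 : N != 0 by apply: contraNneq q0 => e; rewrite eq e scaler0.
have [s1 [t [h1 h2 h3]]] := pick_num_interlace al0 ss c0 N0.
have hp : zeros_of p s1 by rewrite ek; apply: zeros_ofZ.
have hq : zeros_of q t by rewrite eq; apply: zeros_ofZ.
split; [by exists s1|by exists t|constructor 3; split; first by exists s1, t].
move=> x; have := wronskian_pick_num be al0 ss c0 x.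
rewrite ek eq -/P -/N -!mul_polyC -/(wronskian _ _) wronskian_mul => w.
by rewrite hornerM horner_exp mulr_ge0_le0 ?sqr_ge0.
Qed.

(** Real-rootedness of [p] is assumed because a common factor without real zeros leaves no trace in
    the quotient. *)
Lemma pick_prec p q : p != 0 -> real_rooted p ->
  pick_fun (fun x => q.[x] / p.[x]) -> prec p q.
Proof.
have [n] := ubnP (size p); elim: n => // n IH in p q *.
rewrite ltnS => sp p0 rp pq; have [->|q0] := eqVneq q 0.
  by split; [|exact: real_rooted0|constructor 2].
have [[u /factor_theorem [p1 ep] /factor_theorem [q1 eq]]|c] :=
  common_root_or_coprime q p0; last exact: pick_prec_coprime.
have p10 : p1 != 0 by apply: contraNneq p0 => e; rewrite ep e mul0r.
have q10 : q1 != 0 by apply: contraNneq q0 => e; rewrite eq e mul0r.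
have ep' : p = ('X - u%:P) * p1 by rewrite mulrC.
have eq' : q = ('X - u%:P) * q1 by rewrite mulrC.
rewrite ep' eq'; apply/(prec_mulXsubC u p10 q10); apply: IH => //.
- by rewrite ep size_mul ?size_XsubC ?polyXsubC_eq0 // addnC in sp.
- by apply: (@real_rooted_mulXsubC _ u); rewrite -ep'.
- apply: (@pick_fun_ext _ [:: u]) pq => x; rewrite inE => xu.
  by rewrite ep eq !hornerM hornerXsubC -mulf_div divff ?mulr1 // subr_eq0.
Qed.

Lemma prec0r q : prec 0 q <-> real_rooted q.
Proof.
split=> [[]//|rq]; split=> //; first exact: real_rooted0.
by constructor 1.
Qed.

Lemma prec_real_rooted p q : prec p q -> real_rooted p.
Proof. by case. Qed.

Lemma prec_add_affine (al be : R) p q : 0 <= al ->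
  prec p q -> prec p (q + (al *: 'X + be%:P) * p).
Proof.
move=> al0 pq; have [p0|p0] := eqVneq p 0; first by rewrite p0 mulr0 addr0 -p0.
apply: pick_prec => //; first exact: prec_real_rooted pq.
have [bad hb] := finitely_many_roots p0.
apply: (@pick_fun_ext _ bad (fun x => q.[x] / p.[x] + (al * x + be))).
  move=> x /hb px; rewrite hornerD hornerM hornerD hornerZ hornerX hornerC.
  by rewrite mulrDl mulfK.
by apply: pick_funD; [exact: prec_pick|exact: pick_fun_affine].
Qed.

Lemma prec_addZ (k : R) p q : prec p q -> prec p (q + k *: p).
Proof. by move=> /(@prec_add_affine 0 k _ _ (lexx 0)); rewrite scale0r add0r mul_polyC. Qed.

Lemma prec_addX p q : prec p q -> prec p (q + 'X * p).
Proof. by move=> /(@prec_add_affine 1 0 _ _ ler01); rewrite scale1r addr0. Qed.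

Lemma prec_mulXsubC_cancel u p q :
  prec (('X - u%:P) * p) (('X - u%:P) * q) -> prec p q.
Proof.
move=> h; have [p0|p0] := eqVneq p 0.
  rewrite p0; apply/prec0r; apply: (@real_rooted_mulXsubC _ u).
  by case: h.
have X0 : 'X - u%:P != 0 :> {poly R} by rewrite polyXsubC_eq0.
apply: pick_prec => //.
  by apply: (@real_rooted_mulXsubC _ u); exact: prec_real_rooted h.
apply: (@pick_fun_ext _ [:: u]) (prec_pick (mulf_neq0 X0 p0) h) => x.
rewrite inE => xu; rewrite !hornerM hornerXsubC.
by rewrite -mulf_div divff ?mul1r // subr_eq0.
Qed.

(** Letting [h] tend to 0 excludes the pole and then gives the sign of [A]. *)
Lemma pole_bound (k A L : R) : 0 <= k -> 0 <= L ->
  (forall h, 0 < h -> k / h <= A + L * h) -> k = 0 /\ 0 <= A.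
Proof.
move=> k0 L0 H; have k00 : k = 0.
  apply/eqP; rewrite eq_le k0 andbT leNgt; apply/negP => kp.
  have A1 : 0 < `|A| + L + k + 1 by have := normr_ge0 A; lra.
  (* For this [h], which is at most 1, the left side [|A| + L + k + 1] exceeds [A + L h]. *)
  have := H (k / (`|A| + L + k + 1)); rewrite divr_gt0 // => /(_ isT).
  rewrite invf_div mulrCA divff ?gt_eqF // mulr1.
  have h1 : k / (`|A| + L + k + 1) <= 1.
    by rewrite ler_pdivrMr // mul1r; have := normr_ge0 A; lra.
  have := ler_norm A; have := ler_wpM2l L0 h1; lra.
split=> //; rewrite leNgt; apply/negP => A0.
have L1 : 0 < L + 1 by lra.
have := H (- A / (L + 1)); rewrite k00 mul0r divr_gt0 ?oppr_gt0 // => /(_ isT).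
have : L * (- A / (L + 1)) < - A.
  by rewrite mulrCA gtr_pMr ?oppr_gt0 // ltr_pdivrMr //; lra.
lra.
Qed.

(* Dividing a partial fraction by x - u creates a pole at u whose residue is
   the value at u, which is nonnegative because w >= 0 to the right of u. *)
Lemma pick_div_XsubC u p q : p != 0 ->
  (forall x, u < x -> 0 < p.[x]) -> (forall x, u < x -> 0 <= q.[x]) ->
  pick_fun (fun x => q.[x] / p.[x]) ->
  pick_fun (fun x => (- q).[x] / (('X - u%:P) * p).[x]).
Proof.
move=> p0 pp qp /(pick_fun_normal p0) [al [be [s [c [al0 ss c0 rs id]]]]].
have us := lt_sorted_uniq ss.
have su z : z \in s -> z <= u.
  by move=> /rs; rewrite leNgt rootE; apply: contraL => /pp /gt_eqF ->.
pose k := if u \in s then c u else 0.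
have k0 : 0 <= k by rewrite /k; case: ifP => // /c0 /ltW.
pose s' := [seq z <- s | z != u].
have s'P z : z \in s' -> z < u /\ 0 < c z.
  by rewrite mem_filter => /andP [zu zs]; rewrite lt_neqAle zu su ?c0.
have sumE x : \sum_(z <- s) c z / (x - z)
    = k / (x - u) + \sum_(z <- s') c z / (x - z).
  rewrite /s' big_filter /k; case: ifP => hu; first by rewrite (bigD1_seq u).
  rewrite mul0r add0r [RHS]big_seq_cond big_seq; apply: eq_bigl => z.
  by case: eqP => [->|]; rewrite ?hu ?andbT.
have wE x : p.[x] != 0 -> x \notin s -> q.[x] / p.[x]
    = al * x + be - (k / (x - u) + \sum_(z <- s') c z / (x - z)).
  move=> px xs; rewrite -sumE.
  have Px : (\prod_(z <- s) ('X - z%:P)).[x] != 0.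
    by rewrite -[_ == 0]rootE root_prod_XsubC.
  have /(congr1 (fun g => g.[x])) := id; rewrite !hornerM horner_pick_num // => idx.
  apply: (mulIf px); rewrite divfK //; apply: (mulIf Px); rewrite idx.
  by ring.
(* [A] is the value at [u] once a possible pole there is split off; by convexity of [1 / (x - z)]
   the rest is at most [A + L h] at [u + h]. *)
pose A := al * u + be - \sum_(z <- s') c z / (u - z).
pose L := al + \sum_(z <- s') c z / (u - z) ^+ 2.
have [|h h0|k00 A0] := @pole_bound k A L k0.
- rewrite addr_ge0 // big_seq sumr_ge0 // => z /s'P [_ cz].
  by rewrite divr_ge0 ?sqr_ge0 // ltW.
- have ux : u < u + h by lra.
  have px := pp _ ux; have := divr_ge0 (qp _ ux) (ltW px).
  rewrite wE; first last.
  + by apply/negP => /su; rewrite leNgt ux.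
  + by rewrite gt_eqF.
  have -> : u + h - u = h by ring.
  have : \sum_(z <- s') c z / (u - z) - h * \sum_(z <- s') c z / (u - z) ^+ 2
      <= \sum_(z <- s') c z / (u + h - z).
    rewrite mulr_sumr -sumrB big_seq [leRHS]big_seq; apply: ler_sum => z /s'P [zu cz].
    have a0 : 0 < u - z by lra.
    have -> : u + h - z = (u - z) + h by ring.
    set a := u - z in a0 *.
    rewrite -subr_ge0.
    have -> : c z / (a + h) - (c z / a - h * (c z / a ^+ 2))
        = c z * h ^+ 2 / ((a + h) * a ^+ 2).
      by field; rewrite gt_eqF //= gt_eqF //; lra.
    by rewrite divr_ge0 ?mulr_ge0 ?sqr_ge0 ?ltW //; lra.
  rewrite /A /L; lra.
have [bad hb] := finitely_many_roots p0.
(* Uses [1 / ((x - z) (x - u)) = (1 / (x - u) - 1 / (x - z)) / (u - z)]; the terms in [1 / (x - u)]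
   collect into [- A / (x - u)]. *)
pose f z x := - (c z / (u - z) / (x - z)).
apply: (@pick_fun_ext _ (u :: s ++ bad)
  (fun x => 0 * x + - al + (- (A / (x - u)) + \sum_(z <- s') f z x))).
  move=> x; rewrite inE mem_cat !negb_or => /and3P [xu xs /hb px].
  have xu0 : x - u != 0 by rewrite subr_eq0.
  transitivity (- (q.[x] / p.[x]) / (x - u)); last first.
    by rewrite hornerN hornerM hornerXsubC; field; rewrite px xu0.
  rewrite wE // k00 mul0r add0r.
  have -> : \sum_(z <- s') f z x = (\sum_(z <- s') c z / (x - z)) / (x - u)
      - (\sum_(z <- s') c z / (u - z)) / (x - u).
    rewrite !mulr_suml -sumrB big_seq [RHS]big_seq; apply: eq_bigr => z zs'.
    have [zu _] := s'P _ zs'.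
    have zs : z \in s by move: zs'; rewrite mem_filter => /andP [].
    have xz : x - z != 0 by rewrite subr_eq0; apply: contraNneq xs => ->.
    have uz : u - z != 0 by rewrite subr_eq0 gt_eqF.
    by rewrite /f; field; rewrite xz uz xu0.
  by rewrite /A; field.
apply: pick_funD; first exact: pick_fun_affine.
apply: pick_funD; first exact: pick_fun_pole.
apply: pick_fun_sum => z /s'P [zu cz]; apply: pick_fun_pole.
by rewrite divr_ge0 ?subr_ge0 ?ltW.
Qed.

(** By [pick_div_XsubC] the polynomial [(x - u) p] precedes [- q], and [prec_swap] reverses the
    pair. *)
Lemma prec_mulXsubC_right u p q :
  (p != 0 -> forall x, u < x -> 0 < p.[x]) -> (forall x, u < x -> 0 <= q.[x]) ->
  prec p q -> prec q (('X - u%:P) * p).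
Proof.
move=> pp qp pq; have [p0|p0] := eqVneq p 0.
  rewrite p0 mulr0; split; [by case: pq|exact: real_rooted0|by constructor 2].
have X0 : 'X - u%:P != 0 :> {poly R} by rewrite polyXsubC_eq0.
apply: prec_swap; apply: pick_prec.
- exact: mulf_neq0.
- apply: real_rootedM (prec_real_rooted pq).
  by exists [:: u]; exact: zeros_of_XsubC.
- by apply: pick_div_XsubC (prec_pick p0 pq) => //; exact: pp.
Qed.

End PrecCriterion.

(** * Moebius substitutions *)

Section MoebiusTransform.
Variables (R : realType) (e : R).
Hypothesis e0 : e != 0.
Implicit Types (d : nat) (p q : {poly R}) (x y z : R).

Lemma moebius_denominator x : x != - e^-1 -> 1 + e * x != 0.
Proof.
apply: contraNneq => ex; apply/eqP; apply: (mulfI e0).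
by rewrite mulrN divff //; lra.
Qed.

(** The substitution preserves the upper half-plane. The linear term turns into a pole at [- 1 / e],
    a pole at [1 / e] into a linear term, and any other pole [z] moves to [z / (1 - e z)]. *)
Lemma pick_fun_moebius (w : R -> R) :
  pick_fun w -> pick_fun (fun x => w (x / (1 + e * x))).
Proof.
move=> [al [be [r [bad [al0 r0 hw]]]]].
have moebK x : 1 + e * x != 0 ->
    x / (1 + e * x) / (1 - e * (x / (1 + e * x))) = x.
  move=> ex; field; rewrite ex.
  have -> : 1 + e * x - e * x = 1 by ring.
  by rewrite oner_neq0.
(* [g] is the inverse substitution; it transports the exceptional set. *)
pose g y := y / (1 - e * y).
pose f (i : R * R) x := - (i.2 / (x / (1 + e * x) - i.1)).
apply: (@pick_fun_ext _ (- e^-1 :: map g bad)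
  (fun x => (- (al / e ^+ 2 / (x - (- e^-1))) + (be + al / e)) + \sum_(i <- r) f i x)).
  move=> x; rewrite inE negb_or => /andP [xe xb].
  have ex := moebius_denominator xe.
  rewrite hw; last by apply: contra xb => /(map_f g); rewrite /g moebK.
  rewrite /pfrac /f -sumrN; congr (_ + _); field.
  by rewrite ex e0.
apply: pick_funD.
  apply: pick_funD; last exact: pick_fun_const.
  by apply: pick_fun_pole; rewrite divr_ge0 ?sqr_ge0.
apply: pick_fun_sum => -[z k] /r0 /= k0; rewrite /f /=.
have [ez|ez] := eqVneq (1 - e * z) 0.
  have z1 : z = e^-1.
    by apply: (mulfI e0); rewrite divff //; move/eqP: ez; rewrite subr_eq0 => /eqP.
  apply: (@pick_fun_ext _ [:: - e^-1] (fun x => k * e ^+ 2 * x + k * e)).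
    move=> x; rewrite inE => xe.
    have ex := moebius_denominator xe.
    have -> : x / (1 + e * x) - z = - (e * (1 + e * x))^-1.
      by rewrite z1; field; rewrite ex e0.
    by rewrite invrN invrK; ring.
  by apply: pick_fun_affine; rewrite mulr_ge0 ?sqr_ge0.
apply: (@pick_fun_ext _ [:: - e^-1; z / (1 - e * z)] (fun x =>
    - (k / (1 - e * z) ^+ 2 / (x - z / (1 - e * z))) + - (k * e / (1 - e * z)))).
  move=> x; rewrite !inE negb_or => /andP [xe xz].
  have ex := moebius_denominator xe.
  have xz0 : (1 - e * z) * x - z != 0.
    apply: contra xz => /eqP h; apply/eqP; apply: (mulfI ez).
    by rewrite [RHS]mulrC divfK //; lra.
  have -> : x / (1 + e * x) - z = ((1 - e * z) * x - z) / (1 + e * x).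
    by field.
  have -> : x - z / (1 - e * z) = ((1 - e * z) * x - z) / (1 - e * z).
    by field.
  field; rewrite ez ex xz0 //=.
by apply: pick_funD; [apply: pick_fun_pole; rewrite divr_ge0 ?sqr_ge0|exact: pick_fun_const].
Qed.

(** This is [fpoly] for [e = 1] and its inverse, on degree at most [d], for [e = -1]. *)
Definition moebius d p : {poly R} :=
  \sum_(i < d.+1) p`_i *: ('X^i * (1 + e *: 'X) ^+ (d - i)).

Lemma horner_moebius d p x : (size p <= d.+1)%N -> 1 + e * x != 0 ->
  (moebius d p).[x] = (1 + e * x) ^+ d * p.[x / (1 + e * x)].
Proof.
move=> sp x0; rewrite (horner_coef_wide _ sp) horner_sum mulr_sumr.
apply: eq_bigr => i _; rewrite hornerZ hornerM hornerXn horner_exp.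
rewrite hornerD hornerZ hornerX -[1 in LHS]/(1%:P) hornerC.
have hi : (i <= d)%N by rewrite -ltnS ltn_ord.
have -> : (1 + e * x) ^+ d = (1 + e * x) ^+ (d - i) * (1 + e * x) ^+ i.
  by rewrite -exprD subnK.
rewrite exprMn exprVn.
have : (1 + e * x) ^+ i != 0 by rewrite expf_neq0.
by move=> h; field.
Qed.

Lemma size_moebius d p : (size (moebius d p) <= d.+1)%N.
Proof.
apply: (big_ind (fun g : {poly R} => (size g <= d.+1)%N)).
- by rewrite size_poly0.
- by move=> g h hg hh; apply: leq_trans (size_polyD _ _) _; rewrite geq_max hg.
- move=> [i hi] _ /=; apply: leq_trans (size_scale_leq _ _) _.
  apply: leq_trans (size_polyMleq _ _) _; rewrite size_polyXn /=.
  have h1 : (size (1 + e *: 'X : {poly R})%R <= 2)%N.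
    apply: leq_trans (size_polyD _ _) _; rewrite size_poly1 geq_max /=.
    by apply: leq_trans (size_scale_leq _ _) _; rewrite size_polyX.
  have h2 : (size ((1 + e *: 'X : {poly R}) ^+ (d - i))%R <= (d - i).+1)%N.
    apply: leq_trans (size_poly_exp_leq _ _) _; rewrite ltnS.
    rewrite -[leqRHS]mul1n leq_mul2r; apply/orP; right.
    by case: (size _) h1 => [|[|[|]]].
  apply: (@leq_trans (i + (d - i).+1)%N); first by rewrite leq_add2l.
  by rewrite addnS subnKC.
Qed.

Lemma moebius0 d : moebius d 0 = 0.
Proof. by rewrite /moebius big1 // => i _; rewrite coef0 scale0r. Qed.

Lemma real_rooted_moebius d p : (size p <= d.+1)%N ->
  real_rooted p -> real_rooted (moebius d p).
Proof.
move=> sp [s hs]; have [->|p0] := eqVneq p 0; first by rewrite moebius0; exact: real_rooted0.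
pose L (a b : R) : {poly R} := a *: 'X + b%:P.
(* Each zero [z] gives a factor [(1 - e z) x - z], constant if [z = 1 / e], and each degree missing
   up to [d] a factor [1 + e x]. *)
have -> : moebius d p = (lead_coef p)%:P * L e 1 ^+ (d - size s)
    * \prod_(z <- s) L (1 - e * z) (- z).
  apply: (@poly_eq_cofinite _ [:: - e^-1]) => x; rewrite inE => xe.
  have ex := moebius_denominator xe.
  rewrite horner_moebius // {1}hs hornerZ !hornerM hornerC horner_exp !horner_prod.
  have -> : (L e 1).[x] = 1 + e * x by rewrite /L !hornerE addrC.
  have ss : (size s <= d)%N by rewrite -ltnS -(size_zeros p0 hs).
  have -> : \prod_(z <- s) (L (1 - e * z) (- z)).[x]
      = (1 + e * x) ^+ size s * \prod_(z <- s) ('X - z%:P).[x / (1 + e * x)].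
    elim: (s) => [|z r IH]; first by rewrite !big_nil mulr1.
    by rewrite !big_cons IH exprS !hornerE /=; field.
  by rewrite -{1}(subnK ss) exprD; ring.
apply: real_rootedM.
  apply: real_rootedM; first exact: real_rootedC.
  elim: (d - size s)%N => [|n IH]; first by rewrite expr0; exact: (real_rootedC 1).
  by rewrite exprS; apply: real_rootedM IH; exact: real_rooted_linear.
elim: (s) => [|z r IH]; first by rewrite big_nil; exact: (real_rootedC 1).
by rewrite big_cons; apply: real_rootedM IH; exact: real_rooted_linear.
Qed.

End MoebiusTransform.

(** * Interlacing under the substitutions; reversal and reflection *)

Section MoebiusPrec.
Variable R : realType.
Implicit Types (d : nat) (e x : R) (p q a b : {poly R}).

Lemma moebiusK e d p : e != 0 -> (size p <= d.+1)%N ->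
  moebius (- e) d (moebius e d p) = p.
Proof.
move=> e0 sp; have e0' : - e != 0 by rewrite oppr_eq0.
apply: (@poly_eq_cofinite _ [:: - (- e)^-1]) => x; rewrite inE => xe.
have ex := moebius_denominator e0' xe.
have den : 1 + e * (x / (1 + - e * x)) = (1 + - e * x)^-1.
  by field.
rewrite horner_moebius ?size_moebius // horner_moebius // den ?invr_eq0 //.
by rewrite invrK divfK // mulrA -exprMn divff // expr1n mul1r.
Qed.

Lemma prec_moebius e d p q : e != 0 -> (size p <= d.+1)%N -> (size q <= d.+1)%N ->
  prec p q -> prec (moebius e d p) (moebius e d q).
Proof.
move=> e0 sp sq pq; have [p0|p0] := eqVneq p 0.
  rewrite p0 moebius0; apply/prec0r; apply: real_rooted_moebius => //.
  by case: pq.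
have m0 : moebius e d p != 0.
  by apply: contraNneq p0 => h; rewrite -(moebiusK e0 sp) h moebius0.
apply: pick_prec => //.
  by apply: real_rooted_moebius => //; exact: prec_real_rooted pq.
apply: (@pick_fun_ext _ [:: - e^-1]) (pick_fun_moebius e0 (prec_pick p0 pq)) => x.
rewrite inE => xe; have ex := moebius_denominator e0 xe.
rewrite !horner_moebius // -mulf_div divff ?mul1r //.
by rewrite expf_neq0.
Qed.

Lemma fpoly_moebius d p : fpoly d p = moebius 1 d p.
Proof. by rewrite /fpoly /moebius scale1r. Qed.

Lemma size_Irev d p : (size (Irev d p) <= d.+1)%N.
Proof.
apply: (big_ind (fun g : {poly R} => (size g <= d.+1)%N)).
- by rewrite size_poly0.
- by move=> g h hg hh; apply: leq_trans (size_polyD _ _) _; rewrite geq_max hg.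
- move=> i _; apply: leq_trans (size_scale_leq _ _) _.
  by rewrite size_polyXn ltnS leq_subr.
Qed.

(** Away from [0] and [-1] both sides equal [x^d p((1 + x) / x)]. *)
Lemma Rrefl_fpoly d p : (size p <= d.+1)%N ->
  Rrefl d (fpoly d p) = fpoly d (Irev d p).
Proof.
move=> sp; apply: (@poly_eq_cofinite _ [:: 0; - 1]) => x.
rewrite !inE negb_or => /andP [x0 x1].
have x10 : 1 + x != 0 by rewrite addrC -[1]opprK subr_eq0.
have e1 : 1 + (- 1 - x) = - x by ring.
rewrite horner_Rrefl horner_fpoly ?e1 ?oppr_eq0 // horner_fpoly ?size_Irev //.
rewrite horner_Irev // ?mulf_neq0 ?invr_eq0 // !mulrA -!exprMn.
have -> : (x / (1 + x))^-1 = (- 1 - x) / - x by field; rewrite x0 x10.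
by rewrite mulN1r opprK [(1 + x) * _]mulrC divfK.
Qed.

(** Reversing [x b] in degree [d] is reversing [b] in degree [d - 1], which fixes [b]. *)
Lemma Irev_decomposition d p a b : (1 <= d)%N -> (size p <= d.+1)%N ->
  Idecomposition d p a b -> Irev d p = a + b.
Proof.
move=> d1 sp [ep sa sb ia ib]; apply: (@poly_eq_cofinite _ [:: 0]) => x.
rewrite inE => x0; rewrite horner_Irev // hornerD -{1}ia -{1}ib.
rewrite !horner_Irev // ?prednK // ep hornerD hornerM hornerX mulrDr mulrA.
by congr (_ + _ * _); rewrite -{1}(prednK d1) exprSr mulfK.
Qed.

Lemma horner_ge0_coef p x : (forall i, 0 <= p`_i) -> 0 <= x -> 0 <= p.[x].
Proof.
move=> p0 x0; rewrite horner_coef sumr_ge0 // => i _.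
by rewrite mulr_ge0 ?exprn_ge0.
Qed.

Lemma horner_gt0_coef p x : (forall i, 0 <= p`_i) -> p != 0 -> 0 < x -> 0 < p.[x].
Proof.
move=> p0 pn0 x0; rewrite horner_coef.
have sp : (0 < size p)%N by rewrite size_poly_gt0.
have hl : ((size p).-1 < size p)%N by rewrite prednK.
rewrite (bigD1 (Ordinal hl)) //=; apply: ltr_wpDr.
  by rewrite sumr_ge0 // => i _; rewrite mulr_ge0 ?exprn_ge0 // ltW.
rewrite mulr_gt0 ?exprn_gt0 // lt_neqAle p0 andbT eq_sym.
by rewrite -/(lead_coef p) lead_coef_eq0.
Qed.

End MoebiusPrec.

(** * The cycle of implications *)

Theorem theorem2p8 (R : realType) (d : nat) (p a b : {poly R})
    (d_ge1 : (1 <= d)%N) (size_p : (size p <= d.+1)%N)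
    (decomp_p : Idecomposition d p a b)
    (a_ge0 : forall i, 0 <= a`_i) (b_ge0 : forall i, 0 <= b`_i) :
  [<-> prec b a;
       prec a p;
       prec b p;
       prec (Irev d p) p;
       prec (Rrefl d (fpoly d p)) (fpoly d p)].
Proof.
have e10 : 1 != 0 :> R by exact: oner_neq0.
have X0 : 'X = 'X - 0%:P :> {poly R} by rewrite subr0.
have eI := Irev_decomposition d_ge1 size_p decomp_p.
have ep : p = a + 'X * b by case: decomp_p.
have ab_ge0 i : 0 <= (a + b)`_i by rewrite coefD addr_ge0.
have p_ge0 i : 0 <= p`_i.
  by rewrite ep coefD coefXM addr_ge0 //; case: ifP.
have Xa_ge0 x : 0 < x -> 0 <= ('X * b).[x].
  by move=> x0; rewrite hornerM hornerX mulr_ge0 ?horner_ge0_coef ?ltW.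
have X1b x : 1 < x -> 0 <= (('X - 1%:P) * b).[x].
  move=> x1; rewrite hornerM hornerXsubC mulr_ge0 //; first lra.
  by apply: horner_ge0_coef => //; lra.
have gt1 (q : {poly R}) : (forall i, 0 <= q`_i) -> q != 0 ->
    forall x, 1 < x -> 0 < q.[x].
  by move=> q0 qn0 x x1; apply: horner_gt0_coef => //; lra.
tfae.
(* The rule at [u = 0] gives [a ≺ x b], to which [a] is added. *)
- move=> h; have : prec a ('X * b).
    rewrite X0; apply: prec_mulXsubC_right h; first by move=> b0 x; exact: horner_gt0_coef.
    by move=> x x0; apply: horner_ge0_coef => //; exact: ltW.
  by move=> /(prec_addZ 1); rewrite scale1r addrC -ep.
(* From [a ≺ x b] the rule at [u = 0] gives [x b ≺ x a]; cancelling [x] leaves [b ≺ a], to which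
   [x b] is added. *)
- move=> /(prec_addZ (-1)); rewrite scaleN1r ep addrAC subrr add0r => h.
  apply: prec_addX; apply: (@prec_mulXsubC_cancel _ 0).
  rewrite -X0 {2}X0; apply: prec_mulXsubC_right h => // a0 x.
  exact: horner_gt0_coef.
(* The rule at [u = 1] gives [p ≺ (x - 1) b]; subtracting [p] on the right leaves [- (a + b)]. *)
- move=> /(@prec_mulXsubC_right _ 1) h; rewrite eI; apply: prec_swap.
  have -> : - (a + b) = ('X - 1%:P) * b + (-1) *: p.
    by rewrite ep -mul_polyC polyCN; ring.
  apply: prec_addZ; apply: h; first by move=> b0; exact: gt1.
  by move=> x x1; apply: horner_ge0_coef => //; lra.
- move=> h; rewrite Rrefl_fpoly // !fpoly_moebius.
  by apply: prec_moebius => //; exact: size_Irev.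
(* Undoing the substitution gives [a + b ≺ p], hence [a + b ≺ (x - 1) b]. The rule at [u = 1] and
   cancelling [x - 1] give [b ≺ a + b], from which [b] is subtracted. *)
- rewrite Rrefl_fpoly // !fpoly_moebius => h.
  have {}h : prec (a + b) p.
    rewrite -eI -(moebiusK e10 (size_Irev d p)) -{2}(moebiusK e10 size_p).
    by apply: prec_moebius; rewrite ?oppr_eq0 ?size_moebius.
  have {}h : prec (a + b) (('X - 1%:P) * b).
    have -> : ('X - 1%:P) * b = p + (-1) *: (a + b).
      by rewrite ep -mul_polyC polyCN; ring.
    exact: prec_addZ.
  have {}h : prec b (a + b).
    apply: (@prec_mulXsubC_cancel _ 1); apply: prec_mulXsubC_right h => //.
    by move=> ab0; exact: gt1.
  have -> : a = (a + b) + (-1) *: b by rewrite scaleN1r addrK.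
  exact: prec_addZ.
Qed.
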